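(* Consider the gauge action of the group $L\mathfrak N_+$ on $\mathbb Y_q=\{\Lambda+A: A\in L\mathfrak b_+\}\subset L\mathfrak{gl}_q$ given by $$\mathcal L\mapsto{}^hT\cdot\mathcal L\cdot T^{-1},\qquad T\in L\mathfrak N_+ .$$ 1. The gauge action of $L\mathfrak N_+$ on $\mathbb Y_q$ is free. 2. The set of companion matrices, i.e. matrices of the form $$\widetilde{\mathcal L}=\begin{pmatrix}u_1(t,z)&u_2(t,z)&u_3(t,z)&\dots\\1&0&0&\dots\\0&1&0&\dots\\\vdots&\vdots&\ddots&\dots\end{pmatrix},\qquad u_i(t,z)\in\mathcal A_0((z^{-1})),$$ is a cross-section of this action.
   Context: Fix $q\in\mathbb C$, $0<|q|<1$, with $\ln q$ defined by the branch $-\pi<\arg<\pi$, $\ln1=0$, and $q^w=\exp(w\ln q)$. $\mathcal A_0$ is the algebra of functions of a complex variable $w$ generated by $w,q^w,q^{-w}$ (i.e. finite linear combinations of $w^mq^{nw}$, $m\ge0$, $n\in\mathbb Z$). An $\mathcal A_0$-function of two variables is an element of $\mathcal A_0\otimes\mathcal A_0$ (finite sum of products $f^{(1)}(w)f^{(2)}(t)$). For an associative algebra $\mathfrak a$, $\mathfrak{gl}_\infty(\mathfrak a)$ is the algebra of matrices $A=(A_{i,j})_{i,j=0,1,\dots}$, $A_{i,j}\in\mathfrak a$, with $A_{i,j}=0$ if $i-j>N(A)$. $\mathfrak{gl}_q\subset\mathfrak{gl}_\infty(\mathcal A_0)$ consists of the matrices $A(t)=(A_{i,j}(t))$ with entries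 in $\mathcal A_0$ for which there is an integer $N(A)$ such that: (1) $A_{i,i+n}(t)=0$ if $n<-N(A)$; (2) for any fixed $n\ge-N(A)$, there is an $\mathcal A_0$-function of two variables $f(w,t)$ with $A_{i,i+n}(t)=f(i,t)$ for all $i>N(A)$ and all $t$; (3) for all integers $m>N(A)$, and $N(A)<i<m$, $j\ge m$, one has $A_{i,j}(m)=0$. The minimal possible $N(A)$ is the regularity degree $\mathrm{reg}\,A$. For a formal Laurent series or a matrix of such series, the superscript $[m]$ denotes the coefficient of $z^m$. The loop algebra $L\mathfrak{gl}_q$ consists of the matrices $A\in\mathfrak{gl}_\infty(\mathcal A_0((z^{-1})))$ such that: (1) $A^{[m]}\in\mathfrak{gl}_q$ for every $m\in\mathbb Z$; (2) there is an integer $N(A)$ with $\mathrm{reg}\,A^{[m]}\le N(A)$ for all $m$; (3) for every $n\in\mathbb Z$ there is an integer $\tilde N(A,n)$ with $A^{[m]}_{i,i+n}(t)=0$ for all $i$ if $m>\tilde N(A,n)$. $L\mathfrak b_+$ (resp. $L\mathfrak n_+$) is the subalgebra of upper triangular (resp. strictly upper triangular) matrices in $L\mathfrak{gl}_q$; $L\mathfrak N_+=\{1+S:S\in L\mathfrak n_+\}$ is a group. $\Lambda$ is the matrix with $\Lambda_{i+1,i}=1$ for $i\ge0$ and all other entries zero. $({}^hT)(t,z)=T(t,qz)$. The affine space $\mathbb Y_q$ is preserved by the gauge action. A cross-section is a set meeting every orbit in exactly one point. *)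

(* Defs.v *)
From mathcomp Require Import all_boot all_order all_algebra.
From mathcomp Require Import complex.
From mathcomp Require Import all_classical all_reals all_analysis.

Set Implicit Arguments.
Unset Strict Implicit.
Unset Printing Implicit Defensive.

Import Order.TTheory GRing.Theory Num.Theory.

Local Open Scope classical_set_scope.
Local Open Scope ring_scope.
Local Open Scope complex_scope.

Definition cexp (R : realType) (z : R[i]) : R[i] :=
  (expR (complex.Re z) * cos (complex.Im z))
    +i* (expR (complex.Re z) * sin (complex.Im z)).

(* [l] is the value of ln at [q], for the branch -pi < arg < pi, ln 1 = 0.
   Such an [l] is unique; it exists iff [q] is nonzero and not a negative
   real. *)
Definition is_ln (R : realType) (q l : R[i]) : Prop :=
  cexp l = q /\ - pi < complex.Im l < pi.

(* q^w, as a function of l = ln q *)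
Definition qpow (R : realType) (l w : R[i]) : R[i] := cexp (w * l).

(* The item (c, m, n) of [s] stands for the term c w^m q^(nw). *)
Definition A0 (R : realType) (l : R[i]) : set (R[i] -> R[i]) :=
  [set f | exists s : seq (R[i] * nat * int),
     forall w, f w = \sum_(x <- s) x.1.1 * w ^+ x.1.2 * qpow l (x.2%:~R * w)].

(* The elements of A_0 (x) A_0, as functions of (w, t). *)
Definition A0_2 (R : realType) (l : R[i]) : set (R[i] -> R[i] -> R[i]) :=
  [set f | exists (p : nat) (g h : 'I_p -> R[i] -> R[i]),
     (forall k, A0 l (g k) /\ A0 l (h k)) /\
     (forall w t, f w t = \sum_(k < p) g k w * h k t)].

Definition gl_infty (V : zmodType) (a : set V) : set (nat -> nat -> V) :=
  [set A | (forall i j, a (A i j)) /\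
     exists N : int, forall i j : nat, N < i%:Z - j%:Z -> A i j = 0].

(* The three conditions on A, for a given value of N(A). *)
Definition regular_for (R : realType) (l : R[i])
    (A : nat -> nat -> R[i] -> R[i]) (N : int) : Prop :=
  [/\ forall (i j : nat) (n : int), j%:Z = i%:Z + n -> n < - N -> A i j = 0,
      forall n : int, - N <= n -> exists f, A0_2 l f /\
        forall i j : nat, j%:Z = i%:Z + n -> N < i%:Z ->
        forall t, A i j t = f i%:R t
    & forall m : int, N < m -> forall i j : nat,
        N < i%:Z -> i%:Z < m -> m <= j%:Z -> A i j m%:~R = 0].

Definition gl_q (R : realType) (l : R[i]) : set (nat -> nat -> R[i] -> R[i]) :=
  [set A | gl_infty (A0 l) A /\ exists N : int, regular_for l A N].

(* The least N such that [regular_for l A N]. It is an extended real because the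
   zero matrix is regular for every (also every negative) N, so that its
   degree is -oo; for A nonzero in gl_q the infimum is attained. *)
Definition reg (R : realType) (l : R[i]) (A : nat -> nat -> R[i] -> R[i]) :
    \bar R :=
  ereal_inf [set (N%:~R)%:E | N in [set N : int | regular_for l A N]].

(* A series in z (or a formal bilateral one) is the family of its
   coefficients: u^[m] is [u m]. *)
Definition series_z (R : realType) : Type := int -> R[i] -> R[i].

(* A_0((z^-1)) *)
Definition A0_laurent (R : realType) (l : R[i]) : set (series_z R) :=
  [set u | (forall m, A0 l (u m)) /\
     exists M : int, forall m, M < m -> u m = 0].

(* A sum [\sum_(i \in A) F i] is over the support of F in A, which has to be
   finite (the value is 0 otherwise). This is so for the product of two
   Laurent series, and for the product of two matrices of [gl_infty]. *)
Definition ser_mul (R : realType) (u v : series_z R) : series_z R :=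
  fun m => \sum_(a \in [set: int]) (fun t => u a t * v (m - a) t).

Definition ser_one (R : realType) : series_z R :=
  fun m t => if m == 0 then 1 else 0.
Arguments ser_one R : clear implicits.

Definition mat (R : realType) : Type := nat -> nat -> series_z R.

Definition mat_mul (R : realType) (A B : mat R) : mat R :=
  fun i j => \sum_(k \in [set: nat]) ser_mul (A i k) (B k j).

Definition mat_one (R : realType) : mat R :=
  fun i j => if i == j then ser_one R else 0.
Arguments mat_one R : clear implicits.

Definition coef_z (R : realType) (A : mat R) (m : int) :
    nat -> nat -> R[i] -> R[i] := fun i j => A i j m.

Definition Lgl_q (R : realType) (l : R[i]) : set (mat R) :=
  [set A | [/\ gl_infty (A0_laurent l) A,
     forall m : int, gl_q l (coef_z A m),
     exists N : int, forall m : int, (reg l (coef_z A m) <= (N%:~R)%:E)%E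
   & forall n : int, exists N : int, forall m : int, N < m ->
       forall i j : nat, j%:Z = i%:Z + n -> coef_z A m i j = 0]].

Definition Lb_plus (R : realType) (l : R[i]) : set (mat R) :=
  [set A | Lgl_q l A /\ forall i j : nat, (j < i)%N -> A i j = 0].

Definition Ln_plus (R : realType) (l : R[i]) : set (mat R) :=
  [set A | Lgl_q l A /\ forall i j : nat, (j <= i)%N -> A i j = 0].

Definition LN_plus (R : realType) (l : R[i]) : set (mat R) :=
  [set mat_one R + S | S in Ln_plus l].

(* The inverse in the group LN_+ *)
Definition LN_inv (R : realType) (l : R[i]) (T : mat R) : mat R :=
  xget 0 [set S | [/\ LN_plus l S, mat_mul T S = mat_one R
                    & mat_mul S T = mat_one R]].

Definition Lambda (R : realType) : mat R :=
  fun i j => if i == j.+1 then ser_one R else 0.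
Arguments Lambda R : clear implicits.

Definition Y_q (R : realType) (l : R[i]) : set (mat R) :=
  [set Lambda R + A | A in Lb_plus l].

(* T(t, z) |-> T(t, qz) multiplies the coefficient of z^m by q^m. *)
Definition h_shift (R : realType) (q : R[i]) (T : mat R) : mat R :=
  fun i j m t => q ^ m * T i j m t.

Definition gauge (R : realType) (q l : R[i]) (T L : mat R) : mat R :=
  mat_mul (mat_mul (h_shift q T) L) (LN_inv l T).

(* The rows and columns, hence also the u_i, are numbered from 0. *)
Definition companion_mat (R : realType) (u : nat -> series_z R) : mat R :=
  fun i j => if i is i'.+1 then (if i' == j then ser_one R else 0) else u j.

Definition companion (R : realType) (l : R[i]) : set (mat R) :=
  [set companion_mat u | u in [set u | forall j, A0_laurent l (u j)]].

(* In the next three definitions [act] is an action of the group [G], with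
   neutral element [e], on [X]. *)
Definition free_action (gT T : Type) (act : gT -> T -> T) (e : gT)
    (G : set gT) (X : set T) : Prop :=
  forall g x, G g -> X x -> act g x = x -> g = e.

Definition orbit_of (gT T : Type) (act : gT -> T -> T) (G : set gT) (x : T) :
    set T := [set act g x | g in G].

Definition cross_section (gT T : Type) (act : gT -> T -> T)
    (G : set gT) (X C : set T) : Prop :=
  C `<=` X /\
  forall x, X x -> exists y, orbit_of act G x `&` C = [set y].

(* Main.v *)
Require Import Defs.
From mathcomp Require Import all_boot all_order all_algebra.
From mathcomp Require Import complex.
From mathcomp Require Import all_classical all_reals all_analysis.
From mathcomp Require Import zify ring.

(** By [gauge_mulr], T takes L = Lambda + A to L' if and only if hT L = L' T, where
    hT is the matrix T(t, qz). This equation is solved diagonal by diagonal,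
    because the products with A involve only previous diagonals of T, while
    Lambda shifts the diagonals by one.

    For L' = L the equation says that T differs from 1, on each new diagonal, by
    a solution of hT_(i+1) = T_i whose first term vanishes. Hence T = 1, and the
    action is free ([gauge_free]).

    The matrix L' is companion if and only if the rows of hT L other than the
    first are the rows of T: (hT L)_(i+1,j) = T_(i,j) ([gauge_companion_rows]). On
    the coefficient of z^m and on one diagonal, this is a first-order difference
    equation in the row index i,
      y_i(t) - q^m y_(i+1)(t) = known terms,
    with a solution that is determined up to a multiple c(t) q^(-mi) of the
    homogeneous one. The algebra A_0 is large enough for the equation to be
    solvable, as w^m q^(nw) can be summed within A_0 ([A0_diff_surj]). The
    vanishing condition in the definition of regular matrices selects c(t): it
    prescribes y_(p-1)(p) = 0 for all large integers p. This condition can be met,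
    by substituting w = t - 1 in the solution ([gauge_step_coef]), and it is
    decisive, because an element of A_0 which vanishes at all large integers is
    zero ([A0_eventually0], [gauge_normalizer_unique]). So every orbit contains
    exactly one companion matrix.

    The inverses of the matrices 1 + S are constructed diagonal by diagonal as well
    ([LN_invP]), which is possible because the regularity conditions can be
    stated for one diagonal at a time ([regular_diag], [Lb_plusP]). *)

Set Implicit Arguments.
Unset Strict Implicit.
Unset Printing Implicit Defensive.
Import Order.TTheory GRing.Theory Num.Theory.
Local Open Scope ring_scope.

(** * Difference equations for polynomials and exponential polynomials *)

Section PolyShift.
Variable K : numFieldType.
Implicit Types P Q : {poly K}.

Local Notation shift P := (P \Po ('X + 1)).

Lemma size_XD1 : size ('X + 1 : {poly K}) = 2.
Proof. by rewrite -[1]/(1%:P) size_XaddC. Qed.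

Lemma size_shift P : size (shift P) = size P.
Proof. exact/size_comp_poly2/size_XD1. Qed.

Lemma lead_coef_shift P : lead_coef (shift P) = lead_coef P.
Proof.
rewrite lead_coef_comp ?size_XD1// -[1]/(1%:P) lead_coefXaddC.
by rewrite expr1n mulr1.
Qed.

Lemma size_diff_le n P Q :
  (size P <= n.+1)%N -> (size Q <= n.+1)%N -> P`_n = Q`_n ->
  (size (P - Q)%R <= n)%N.
Proof.
move=> sP sQ e; apply/leq_sizeP => j; rewrite leq_eqVlt => /orP[/eqP<-|ltnj].
  by rewrite coefB e subrr.
by rewrite coefB !nth_default ?subrr// (leq_trans _ ltnj).
Qed.

(** The leading coefficients cancel. *)
Lemma size_shift_sub n P :
  (size P <= n.+1)%N -> (size (shift P - P)%R <= n)%N.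
Proof.
move=> sP; apply: size_diff_le; rewrite ?size_shift //.
have [sPn|sPn] := ltnP (size P) n.+1.
  by rewrite !nth_default ?size_shift.
have e : n = (size P).-1 by lia.
by have := lead_coef_shift P; rewrite /lead_coef size_shift -e.
Qed.

(** By induction on the degree: it is enough to match the leading term of [P],
    the remainder being of smaller degree. For c != 1 the operator multiplies
    leading coefficients by 1 - c; for c = 1 it lowers the degree by one, so the
    leading term is matched by a multiple of the next power of X. *)
Lemma shift_diff_surj (c : K) P : exists Q, Q - c *: shift Q = P.
Proof.
have [n] := ubnP (size P); elim: n P => // n IHn P; rewrite ltnS => sP.
have [->|P0] := eqVneq P 0; first by exists 0; rewrite comp_poly0 scaler0 subr0.
have sP0 : (0 < size P)%N by rewrite size_poly_gt0.
have [m nE] : exists m, n = m.+1 by case: n sP {IHn} => [|m]; [lia|exists m].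
subst n.
suff [Q0 H] : exists Q0, (size (P - (Q0 - c *: shift Q0))%R <= m)%N.
  have [Q1 HQ1] := IHn _ H; exists (Q0 + Q1).
  rewrite comp_polyD scalerDr opprD addrACA HQ1; ring.
have [->|c1] := eqVneq c 1.
  pose a := P`_m / (m.+1)%:R.
  pose B := a *: 'X^(m.+1); exists (- B).
  have -> : - B - 1 *: shift (- B) = shift B - B.
    by rewrite scale1r raddfN opprK addrC.
  apply: size_diff_le => //.
    apply: size_shift_sub; apply: leq_trans (size_scale_leq _ _) _.
    by rewrite size_polyXn.
  rewrite comp_polyZ comp_Xn_poly coefB !coefZ coefXn.
  rewrite (_ : (m == m.+1) = false); last by lia.
  rewrite mulr0 subr0.
  rewrite exprD1n coef_sum (bigD1 (inord m))//= inordK// coefMn coefXn eqxx.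
  rewrite big1; last first.
    move=> i /eqP ni; rewrite coefMn coefXn.
    case: eqP => [mi|_]; last by rewrite mul0rn.
    by case: ni; apply: val_inj; rewrite /= inordK.
  by rewrite addr0 binSn /= mulr1n /a divfK// pnatr_eq0.
exists ((1 - c)^-1 *: P).
have c10 : 1 - c != 0 by rewrite subr_eq0 eq_sym.
have -> : P - ((1 - c)^-1 *: P - c *: shift ((1 - c)^-1 *: P)) =
   (c / (1 - c)) *: (shift P - P).
  rewrite comp_polyZ scalerA scalerBr opprB addrCA; congr (_ + _).
  rewrite -[X in X - _]scale1r -scalerBl -scaleNr; congr (_ *: _); field.
  exact: c10.
by apply: leq_trans (size_scale_leq _ _) _; apply: size_shift_sub.
Qed.

Lemma poly_eventually0 P N :
  (forall p : nat, (N < p)%N -> P.[p%:R] = 0) -> P = 0.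
Proof.
move=> H; apply/eqP/negPn/negP => P0.
have := @max_poly_roots _ P [seq k%:R | k <- iota N.+1 (size P)] P0.
rewrite size_map size_iota ltnn => H1.
suff: false by [].
apply: H1.
  apply/allP => _ /mapP[k + ->]; rewrite mem_iota => /andP[Nk _].
  by apply/rootP/H.
by rewrite map_inj_uniq ?iota_uniq// => x y /eqP; rewrite eqr_nat => /eqP.
Qed.

(** The operator E - lam b, with E the shift p |-> p + 1, sends
    P(p) (lam c)^p to another such term, whose polynomial factor does not grow
    and loses a degree when c = b. This gives an induction on the total size.
    Once all images vanish, comparing leading coefficients kills the terms with
    c != b, and the remaining polynomial has infinitely many roots. *)
Lemma exp_poly_indep (I : eqType) (bs : seq I) (lam : I -> K)
    (F : I -> {poly K}) N :
  uniq bs -> {in bs &, injective lam} -> (forall b, lam b != 0) ->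
  (forall p : nat, (N < p)%N ->
     \sum_(b <- bs) (F b).[p%:R] * lam b ^+ p = 0) ->
  forall b, b \in bs -> F b = 0.
Proof.
move=> ubs ilam lam0.
have [n] := ubnP (\sum_(b <- bs) size (F b)); elim: n F => // n IHn F.
rewrite ltnS => leFn HF b bbs; apply/eqP/negPn/negP => Fb0.
pose F' c := lam c *: shift (F c) - lam b *: F c.
have szF' c : (size (F' c) <= size (F c))%N.
  rewrite (leq_trans (size_polyD _ _))// geq_max size_polyN.
  by rewrite !(leq_trans (size_scale_leq _ _))// size_shift.
have szF'b : (size (F' b) < size (F b))%N.
  have := size_poly_gt0 (F b); rewrite Fb0 /F' -scalerBr.
  case E : (size (F b)) => [//|s] _; rewrite ltnS.
  by rewrite (leq_trans (size_scale_leq _ _))// size_shift_sub// E.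
have F'0 : forall c, c \in bs -> F' c = 0.
  apply: IHn => [|p Np].
    apply: leq_trans leFn; rewrite !(big_rem b bbs)/= -addSn leq_add//.
    by apply: leq_sum => c _.
  transitivity (\sum_(c <- bs) (F c).[p.+1%:R] * lam c ^+ p.+1
                - lam b * (\sum_(c <- bs) (F c).[p%:R] * lam c ^+ p)).
    rewrite mulr_sumr -sumrB; apply: eq_bigr => c _.
    rewrite hornerD hornerN !hornerZ horner_comp.
    rewrite (_ : ('X + 1).[_] = p.+1%:R) ?exprS; [ring|by rewrite !hornerE natr1].
  by rewrite !HF// ?mulr0 ?subr0// ltnW.
have F0 c : c \in bs -> c != b -> F c = 0.
  move=> cbs cb; apply/eqP; rewrite -lead_coef_eq0.
  have /subr0_eq/(congr1 (@lead_coef K)) := F'0 _ cbs.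
  rewrite !lead_coefZ lead_coef_shift => /eqP.
  rewrite -subr_eq0 -mulrBl mulf_eq0 subr_eq0 => /orP[/eqP|//].
  by move=> /ilam -/(_ cbs bbs)/eqP; rewrite (negPf cb).
move/negP: Fb0; apply; apply/eqP/(@poly_eventually0 _ N) => p Np.
have := HF p Np; rewrite (big_rem b bbs)/= big_seq big1 ?addr0 => [/eqP|c].
  by rewrite mulf_eq0 expf_eq0 (negPf (lam0 b)) andbF orbF => /eqP.
by rewrite mem_rem_uniq// inE => /andP[cb cbs]; rewrite F0// horner0 mul0r.
Qed.
End PolyShift.

(** * The algebra A_0 and its tensor square *)

Section A0Algebra.
Variables (R : realType) (l : R[i]%C).
Local Notation C := (R[i]%C).

Lemma cexpD (x y : C) : cexp (x + y) = cexp x * cexp y.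
Proof.
case: x y => [a b] [c d]; rewrite /cexp /= expRD cosD sinD.
by apply/eqP; rewrite eq_complex /=; apply/andP; split; apply/eqP; ring.
Qed.

Lemma cexp0 : cexp (0 : C) = 1.
Proof. by rewrite /cexp /= expR0 cos0 sin0 mul1r mulr0. Qed.

Lemma qpowD (x y : C) : qpow l (x + y) = qpow l x * qpow l y.
Proof. by rewrite /qpow mulrDl cexpD. Qed.

Lemma qpow0 : qpow l 0 = 1 :> C.
Proof. by rewrite /qpow mul0r cexp0. Qed.

Lemma qpow_neq0 (x : C) : qpow l x != 0.
Proof.
apply/eqP => x0; have := qpowD x (- x).
by rewrite x0 mul0r subrr qpow0 => /eqP; rewrite oner_eq0.
Qed.

Lemma qpow_natM (n : nat) (x : C) : qpow l (n%:R * x) = qpow l x ^+ n.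
Proof.
elim: n => [|n IHn]; first by rewrite mul0r qpow0.
by rewrite -addn1 natrD mulrDl mul1r qpowD IHn exprD expr1.
Qed.

Lemma qpow_intM (n : int) (x : C) : qpow l (n%:~R * x) = qpow l x ^ n.
Proof.
case: n => n; first exact: qpow_natM.
rewrite [RHS]/(_ ^- _). rewrite -qpow_natM NegzE.
have := qpowD (n.+1%:R * x) (- n.+1%:Z%:~R * x).
rewrite -mulrDl subrr mul0r qpow0 => /esym e.
apply: (mulfI (qpow_neq0 (n.+1%:R * x))); by rewrite mulfV ?qpow_neq0.
Qed.

Lemma qpow_int (q : C) (n : int) : cexp l = q -> qpow l n%:~R = q ^ n.
Proof. by move=> <-; rewrite -[n%:~R]mulr1 qpow_intM /qpow mul1r. Qed.

Lemma A0_monomial (c : C) (m : nat) (n : int) :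
  A0 l (fun w => c * w ^+ m * qpow l (n%:~R * w)).
Proof. by exists [:: (c, m, n)] => w; rewrite big_seq1. Qed.

Lemma A0_0 : A0 l 0.
Proof. by exists [::] => w; rewrite big_nil. Qed.

Lemma A0_add f g : A0 l f -> A0 l g -> A0 l (fun w => f w + g w).
Proof.
move=> [s fE] [s' gE]; exists (s ++ s') => w.
by rewrite big_cat/= -fE -gE.
Qed.

Lemma A0_sum (I : Type) (r : seq I) (P : pred I) (F : I -> C -> C) :
  (forall i, P i -> A0 l (F i)) -> A0 l (fun w => \sum_(i <- r | P i) F i w).
Proof.
move=> H; elim: r => [|i r IHr].
  rewrite (_ : (fun w => _) = fun=> 0 : C); first exact: A0_0.
  by apply/funext => w; rewrite big_nil.
rewrite (_ : (fun w => _) =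
  fun w => (if P i then F i w else 0) + \sum_(j <- r | P j) F j w).
  by apply: A0_add => //; case: (P i) (H i) => [/(_ isT)//|_]; exact: A0_0.
by apply/funext => w; rewrite big_cons; case: ifP => //; rewrite add0r.
Qed.

Lemma A0_mul f g : A0 l f -> A0 l g -> A0 l (fun w => f w * g w).
Proof.
move=> [s fE] [s' gE].
rewrite (_ : (fun w => _) = fun w => \sum_(x <- s) \sum_(y <- s')
   (x.1.1 * y.1.1) * w ^+ (x.1.2 + y.1.2) * qpow l ((x.2 + y.2)%:~R * w)).
  by do 2 apply: A0_sum => ? _; exact: A0_monomial.
apply/funext => w; rewrite fE gE mulr_suml; apply: eq_bigr => x _.
rewrite mulr_sumr; apply: eq_bigr => y _.
rewrite exprD intrD mulrDl qpowD; ring.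
Qed.

Lemma A0_cst (c : C) : A0 l (fun=> c).
Proof.
rewrite (_ : (fun=> c) = fun w => c * w ^+ 0 * qpow l (0%:~R * w)).
  exact: A0_monomial.
by apply/funext => w; rewrite mulr1 mul0r qpow0 mulr1.
Qed.

Lemma A0_id : A0 l id.
Proof.
rewrite (_ : id = fun w => 1 * w ^+ 1 * qpow l (0%:~R * w)).
  exact: A0_monomial.
by apply/funext => w; rewrite mul1r mul0r qpow0 mulr1.
Qed.

Lemma A0_qpow (n : int) : A0 l (fun w => qpow l (n%:~R * w)).
Proof.
rewrite (_ : (fun w => _) = fun w => 1 * w ^+ 0 * qpow l (n%:~R * w)).
  exact: A0_monomial.
by apply/funext => w; rewrite mulr1 mul1r.
Qed.

Lemma A0_exp f n : A0 l f -> A0 l (fun w => f w ^+ n).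
Proof.
move=> fA; elim: n => [|n IHn]; first exact: A0_cst.
rewrite (_ : (fun w => _) = fun w => f w * f w ^+ n); first exact: A0_mul.
by apply/funext => w; rewrite exprS.
Qed.

Lemma A0_scale (c : C) f : A0 l f -> A0 l (fun w => c * f w).
Proof. by apply: A0_mul; exact: A0_cst. Qed.

Lemma A0_shift (d : C) f : A0 l f -> A0 l (fun w => f (w + d)).
Proof.
move=> [s fE]; rewrite (_ : (fun w => _) = fun w => \sum_(x <- s)
  x.1.1 * (w + d) ^+ x.1.2 * (qpow l (x.2%:~R * w) * qpow l (x.2%:~R * d))).
  apply: A0_sum => x _; apply: A0_mul; last first.
    by apply: A0_mul; [exact: A0_qpow|exact: A0_cst].
  apply/A0_scale/A0_exp/A0_add; [exact: A0_id|exact: A0_cst].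
apply/funext => w; rewrite fE; apply: eq_bigr => x _.
by rewrite mulrDr qpowD.
Qed.

Lemma A0_horner (P : {poly C}) f : A0 l f -> A0 l (fun w => P.[f w]).
Proof.
move=> fA; rewrite (_ : (fun w => _) =
  fun w => \sum_(i < size P) P`_i * f w ^+ i).
  by apply: A0_sum => i _; apply/A0_scale/A0_exp.
by apply/funext => w; rewrite horner_coef.
Qed.

(** On w^m q^(nw) the operator acts on the polynomial factor as
    Q |-> Q - mu q^n Q(X + 1), which is onto also when mu q^n = 1. *)
Lemma A0_diff_surj (mu : C) g : A0 l g ->
  exists2 f, A0 l f & forall w, f w - mu * f (w + 1) = g w.
Proof.
move=> [s gE].
pose lam n := mu * qpow l (n%:~R).
have /choice[Q QE] : forall x : C * nat * int, exists Q : {poly C},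
    Q - lam x.2 *: (Q \Po ('X + 1)) = x.1.1 *: 'X^(x.1.2).
  by move=> x; exact: shift_diff_surj.
exists (fun w => \sum_(x <- s) (Q x).[w] * qpow l (x.2%:~R * w)).
  apply: A0_sum => x _; apply: A0_mul; last exact: A0_qpow.
  exact/A0_horner/A0_id.
move=> w; rewrite gE mulr_sumr -sumrB; apply: eq_bigr => x _.
have /(congr1 (fun P => P.[w])) := QE x.
rewrite hornerD hornerN !hornerZ horner_comp hornerXn => <-.
rewrite (_ : ('X + 1).[w] = w + 1); last by rewrite !hornerE.
rewrite /lam mulrDr mulr1 qpowD; ring.
Qed.

Section Vanishing.
Variable q : C.
Hypotheses (q_gt0 : 0 < `|q|) (q_lt1 : `|q| < 1) (lE : cexp l = q).

Lemma exprz_inj : injective (exprz q).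
Proof.
have q0 : q != 0 by rewrite -normr_gt0.
suff H (a b : int) : (a <= b)%R -> q ^ a = q ^ b -> a = b.
  by move=> a b; have [/H//|/ltW/H + /esym] := leP a b => /[apply].
move=> ab /esym e.
have [n nE] : exists n : nat, b = a + n%:Z by exists `|b - a|%N; lia.
move: e; rewrite nE expfzDr// -[X in _ = X]mulr1 => /(mulfI (expfz_neq0 _ q0)).
move=> /(congr1 Num.norm); rewrite normr1 normrX => e.
have := exprn_ilt1 n (ltW q_gt0) q_lt1.
by rewrite e ltxx => /esym/negbFE/eqP->; rewrite addr0.
Qed.

(** This is where 0 < |q| < 1 enters: it makes the numbers q^n pairwise
    distinct, so that an element of A_0 is determined by its values at large
    integers. *)
Lemma A0_eventually0 f (N : nat) : A0 l f ->
  (forall p : nat, (N < p)%N -> f p%:R = 0) -> f = 0.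
Proof.
move=> [s fE] f0.
(* The terms of [f] are grouped by the exponent of q^w. *)
pose bs := undup [seq x.2 | x <- s].
pose F (b : int) : {poly C} := \sum_(x <- s | x.2 == b) x.1.1 *: 'X^(x.1.2).
have fF w : f w = \sum_(b <- bs) (F b).[w] * qpow l (b%:~R * w).
  rewrite fE; under [RHS]eq_bigr do rewrite horner_sum mulr_suml.
  rewrite (exchange_big_dep predT)//= big_seq [RHS]big_seq.
  apply: eq_bigr => x xs; rewrite -big_filter.
  rewrite (_ : [seq b <- bs | x.2 == b] = [:: x.2]).
    by rewrite big_seq1 hornerZ hornerXn.
  rewrite (@eq_filter _ _ (pred1 x.2)); last by move=> b; rewrite /= eq_sym.
  by rewrite filter_pred1_uniq ?undup_uniq// mem_undup map_f.
have F0 : forall b, b \in bs -> F b = 0.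
  apply: (@exp_poly_indep _ _ bs (exprz q) F N) => [|||p Np].
  - exact: undup_uniq.
  - by move=> b c _ _; exact: exprz_inj.
  - by move=> b; rewrite expfz_neq0// -normr_gt0.
  - rewrite -[RHS](f0 _ Np) fF; apply: eq_bigr => b _; congr (_ * _).
    by rewrite mulrC qpow_natM (qpow_int _ lE).
apply/funext => w; rewrite fF big_seq big1// => b /F0->.
by rewrite horner0 mul0r.
Qed.

End Vanishing.

Lemma A0_2_prod g h : A0 l g -> A0 l h -> A0_2 l (fun w t => g w * h t).
Proof.
move=> gA hA; exists 1%N, (fun=> g), (fun=> h); split=> // w t.
by rewrite big_ord1.
Qed.

Lemma A0_2_add f g : A0_2 l f -> A0_2 l g -> A0_2 l (fun w t => f w t + g w t).
Proof.
move=> [n [f1 [f2 [fA fE]]]] [m [g1 [g2 [gA gE]]]].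
exists (n + m)%N,
  (fun k => match fintype.split k with inl k => f1 k | inr k => g1 k end),
  (fun k => match fintype.split k with inl k => f2 k | inr k => g2 k end).
split=> [k|w t]; first by case: fintype.split.
rewrite big_split_ord/= fE gE; congr (_ + _); apply: eq_bigr => k _.
  by rewrite (unsplitK (inl k)).
by rewrite (unsplitK (inr k)).
Qed.

Lemma A0_2_0 : A0_2 l 0.
Proof.
by exists 0%N, (fun=> 0), (fun=> 0); split=> [[]//|w t]; rewrite big_ord0.
Qed.

Lemma A0_2_sum (I : Type) (r : seq I) (F : I -> C -> C -> C) :
  (forall i, A0_2 l (F i)) -> A0_2 l (fun w t => \sum_(i <- r) F i w t).
Proof.
move=> H; elim: r => [|i r IHr].
  rewrite (_ : (fun w t => _) = fun _ _ => 0 : C); first exact: A0_2_0.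
  by apply/funext => w; apply/funext => t; rewrite big_nil.
rewrite (_ : (fun w t => _) = fun w t => F i w t + \sum_(j <- r) F j w t).
  exact: A0_2_add.
by apply/funext => w; apply/funext => t; rewrite big_cons.
Qed.

Lemma A0_2_mul f g : A0_2 l f -> A0_2 l g -> A0_2 l (fun w t => f w t * g w t).
Proof.
move=> [n [f1 [f2 [fA fE]]]] [m [g1 [g2 [gA gE]]]].
rewrite (_ : (fun w t => _) = fun w t => \sum_(i < n) \sum_(j < m)
   (f1 i w * g1 j w) * (f2 i t * g2 j t)).
  apply: A0_2_sum => i; apply: A0_2_sum => j.
  have [? ?] := fA i; have [? ?] := gA j.
  by apply: A0_2_prod; exact: A0_mul.
apply/funext => w; apply/funext => t; rewrite fE gE mulr_suml.
apply: eq_bigr => i _; rewrite mulr_sumr; apply: eq_bigr => j _; ring.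
Qed.

Lemma A0_2_r f : A0 l f -> A0_2 l (fun _ t => f t).
Proof.
move=> fA; rewrite (_ : (fun w t => _) = fun _ t => 1 * f t).
  by apply: A0_2_prod => //; exact: A0_cst.
by apply/funext => w; apply/funext => t; rewrite mul1r.
Qed.

Lemma A0_2_shift (d : C) f : A0_2 l f -> A0_2 l (fun w t => f (w + d) t).
Proof.
move=> [n [f1 [f2 [fA fE]]]]; exists n, (fun k w => f1 k (w + d)), f2.
by split=> // k; have [/(A0_shift d)] := fA k.
Qed.

Lemma A0_2_fst (w : C) f : A0_2 l f -> A0 l (f w).
Proof.
move=> [n [f1 [f2 [fA fE]]]].
rewrite (_ : f w = fun t => \sum_(k < n) f1 k w * f2 k t).
  by apply: A0_sum => k _; apply: A0_scale; have [] := fA k.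
exact/funext.
Qed.

Lemma A0_2_diag (d : C) f : A0_2 l f -> A0 l (fun t => f (t + d) t).
Proof.
move=> [n [f1 [f2 [fA fE]]]].
rewrite (_ : (fun w => _) = fun t => \sum_(k < n) f1 k (t + d) * f2 k t).
  by apply: A0_sum => k _; have [? ?] := fA k; apply: A0_mul => //; exact: A0_shift.
exact/funext.
Qed.

Lemma A0_2_diff_surj (mu : C) g : A0_2 l g ->
  exists2 f, A0_2 l f & forall w t, f w t - mu * f (w + 1) t = g w t.
Proof.
move=> [n [g1 [g2 [gA gE]]]].
have /choice[f fP] : forall k : 'I_n, exists f, A0 l f /\
    forall w, f w - mu * f (w + 1) = g1 k w.
  by move=> k; have [/(A0_diff_surj mu)[f ? ?] _] := gA k; exists f.
exists (fun w t => \sum_k f k w * g2 k t).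
  apply: A0_2_sum => k; have [? _] := fP k; have [_ ?] := gA k.
  exact: A0_2_prod.
move=> w t; rewrite gE mulr_sumr -sumrB; apply: eq_bigr => k _.
have [_ <-] := fP k; ring.
Qed.

End A0Algebra.

(** * Products of Laurent series and of infinite matrices *)

Section Series.
Variables (R : realType) (l : R[i]%C).
Local Notation C := (R[i]%C).
Implicit Types u v w : series_z R.

Lemma ser_addE u v m t : (u + v) m t = u m t + v m t.
Proof. by []. Qed.

(** Finiteness of the sums in [ser_mul] depends only on the bound on the powers
    of z; the algebra of products is developed for arbitrary coefficients. *)
Definition laurent u := exists K : nat, forall m : int, K%:Z < m -> u m = 0.

Lemma laurent_bound u M : (forall m : int, M < m -> u m = 0) -> laurent u.
Proof. by move=> H; exists `|M|%N => m Mm; apply: H; lia. Qed.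

(** The range lo, ..., lo + n - 1 only has to contain the relevant indices. This
    freedom puts different products over a common range. *)
Lemma ser_mulE u v (K K' lo m : int) (n : nat) t :
  (forall a : int, K < a -> u a = 0) -> (forall a, K' < a -> v a = 0) ->
  lo + K' <= m -> K < lo + n%:Z ->
  ser_mul u v m t = \sum_(k < n) u (lo + k%:Z) t * v (m - (lo + k%:Z)) t.
Proof.
move=> uK vK loK Kn; rewrite /ser_mul.
rewrite (fsbigE [seq lo + k%:Z | k <- iota 0 n]) ?fct_sumE//; first last.
- move=> a _ /mapP ar; apply/funext => t0.
  have [Ka|aK] := ltP K a; first by rewrite uK// mul0r.
  rewrite vK ?mulr0//; apply: contra_notT ar => ma.
  by exists `|a - lo|%N; [rewrite mem_iota; lia|lia].
- by rewrite map_inj_uniq ?iota_uniq// => x y; lia.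
rewrite big_map -[X in iota 0 X]subn0 big_mkord.
by apply: eq_bigl => k; rewrite in_setT.
Qed.

Lemma ser_mul0r u : ser_mul u 0 = 0.
Proof.
by apply/funext => m; apply: fsbig1 => a _; apply/funext => t; apply: mulr0.
Qed.

Lemma ser_mul0l u : ser_mul 0 u = 0.
Proof.
by apply/funext => m; apply: fsbig1 => a _; apply/funext => t; apply: mul0r.
Qed.

Lemma ser_mul1l u : ser_mul (ser_one R) u = u.
Proof.
apply/funext => m; rewrite /ser_mul (fsbigE [:: 0])//; last first.
  by move=> a _; rewrite inE /ser_one => /negPf->; apply/funext => t; apply: mul0r.
rewrite big_mkcond big_seq1 in_setT /ser_one eqxx subr0.
by apply/funext => t; rewrite mul1r.
Qed.

Lemma ser_mul1r u : ser_mul u (ser_one R) = u.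
Proof.
apply/funext => m; rewrite /ser_mul (fsbigE [:: m])//; last first.
  move=> a _; rewrite inE /ser_one subr_eq0 eq_sym => /negPf->.
  by apply/funext => t; apply: mulr0.
rewrite big_mkcond big_seq1 in_setT /ser_one subrr eqxx.
by apply/funext => t; rewrite mulr1.
Qed.

Lemma laurent0 : laurent 0.
Proof. by exists 0%N. Qed.

Lemma laurent1 : laurent (ser_one R).
Proof.
by exists 0%N => m m0; apply/funext => t; rewrite /ser_one gt_eqF.
Qed.

Lemma laurentD u v : laurent u -> laurent v -> laurent (u + v).
Proof.
move=> [K uK] [K' vK]; exists (K + K')%N => m Km; apply/funext => t.
rewrite ser_addE uK ?vK ?addr0//; lia.
Qed.

Lemma laurent_sum (I : Type) (r : seq I) (F : I -> series_z R) :
  (forall i, laurent (F i)) -> laurent (\sum_(i <- r) F i).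
Proof.
by move=> H; elim/big_rec: _ => [|i u _]; [exact: laurent0|exact: laurentD].
Qed.

Lemma laurent_mul u v : laurent u -> laurent v -> laurent (ser_mul u v).
Proof.
move=> [K uK] [K' vK]; exists (K + K')%N => m Km; apply/funext => t.
rewrite (@ser_mulE _ _ K K' (m - K'%:Z) m 0) ?big_ord0//; lia.
Qed.

Lemma ser_mulDl u u' v : laurent u -> laurent u' -> laurent v ->
  ser_mul (u + u') v = ser_mul u v + ser_mul u' v.
Proof.
move=> Lu Lu' [K' vK]; have [K2 uuK] := laurentD Lu Lu'.
move: Lu Lu' => [K uK] [K1 uK1]; apply/funext => m; apply/funext => t.
pose lo := m - K'%:Z; pose n := (K + K1 + K2 + `|lo|%N).+1.
rewrite ser_addE.
rewrite (@ser_mulE _ _ K2 K' lo m n)//; [|lia..].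
rewrite (@ser_mulE u _ K K' lo m n)//; [|lia..].
rewrite (@ser_mulE u' _ K1 K' lo m n)//; [|lia..].
by rewrite -big_split/=; apply: eq_bigr => k _; rewrite ser_addE mulrDl.
Qed.

Lemma ser_mulDr u v v' : laurent u -> laurent v -> laurent v' ->
  ser_mul u (v + v') = ser_mul u v + ser_mul u v'.
Proof.
move=> [K uK] Lv Lv'; have [K2 vvK] := laurentD Lv Lv'.
move: Lv Lv' => [K' vK] [K1 vK1]; apply/funext => m; apply/funext => t.
pose lo := m - (K' + K1 + K2)%:Z; pose n := (K + `|lo|%N).+1.
rewrite ser_addE.
rewrite (@ser_mulE _ _ K K2 lo m n)//; [|lia..].
rewrite (@ser_mulE _ v K K' lo m n)//; [|lia..].
rewrite (@ser_mulE _ v' K K1 lo m n)//; [|lia..].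
by rewrite -big_split/=; apply: eq_bigr => k _; rewrite ser_addE mulrDr.
Qed.

Lemma ser_mul_sumr (I : Type) (r : seq I) (F : I -> series_z R) u :
  laurent u -> (forall k, laurent (F k)) ->
  ser_mul u (\sum_(k <- r) F k) = \sum_(k <- r) ser_mul u (F k).
Proof.
move=> Lu LF; elim: r => [|k r IHr]; first by rewrite !big_nil ser_mul0r.
by rewrite !big_cons ser_mulDr ?IHr//; exact: laurent_sum.
Qed.

Lemma ser_mul_suml (I : Type) (r : seq I) (F : I -> series_z R) u :
  (forall k, laurent (F k)) -> laurent u ->
  ser_mul (\sum_(k <- r) F k) u = \sum_(k <- r) ser_mul (F k) u.
Proof.
move=> LF Lu; elim: r => [|k r IHr]; first by rewrite !big_nil ser_mul0l.
by rewrite !big_cons ser_mulDl ?IHr//; exact: laurent_sum.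
Qed.

Lemma ser_mulA u v w : laurent u -> laurent v -> laurent w ->
  ser_mul (ser_mul u v) w = ser_mul u (ser_mul v w).
Proof.
move=> [K1 uK1] [K2 vK2] [K3 wK3]; pose K := (K1 + K2 + K3)%:Z.
have uK (a : int) : K < a -> u a = 0 by move=> ?; apply: uK1; lia.
have vK (a : int) : K < a -> v a = 0 by move=> ?; apply: vK2; lia.
have wK (a : int) : K < a -> w a = 0 by move=> ?; apply: wK3; lia.
have mulK u' v' : (forall a : int, K < a -> u' a = 0) ->
    (forall a : int, K < a -> v' a = 0) ->
    forall a : int, K + K < a -> ser_mul u' v' a = 0.
  move=> uK' vK' a Ka; apply/funext => t.
  rewrite (@ser_mulE _ _ K K (a - K) a 0) ?big_ord0//; lia.
apply/funext => m; apply/funext => t.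
(* A common bound K for the three series leaves the ranges
   m - K, ..., 2 K for the degree a of u v and m - 2 K, ..., K for the degree
   b of u; on the other side v w is indexed by a - b. *)
pose n := `|(K + K + K - m + 1)%R|%N.
rewrite (@ser_mulE _ _ (K + K) K (m - K) m n)//; [|exact: mulK|lia..].
rewrite (@ser_mulE _ _ K (K + K) (m - K - K) m n)//; [|exact: mulK|lia..].
transitivity (\sum_(a < n) \sum_(b < n)
    u (m - K - K + b%:Z) t * v (m - K + a%:Z - (m - K - K + b%:Z)) t *
    w (m - (m - K + a%:Z)) t).
  apply: eq_bigr => a _.
  by rewrite (@ser_mulE _ _ K K (m - K - K) _ n)//; [rewrite mulr_suml|lia..].
rewrite exchange_big; apply: eq_bigr => b _.
have [bK|Kb] := leP (m - K - K + b%:Z) K; last first.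
  by rewrite (uK _ Kb) mul0r big1// => a _; rewrite !mul0r.
rewrite (@ser_mulE _ _ K K (m - K - (m - K - K + b%:Z)) _ n)//; [|lia..].
rewrite mulr_sumr; apply: eq_bigr => a _; rewrite mulrA.
by congr (_ * v _ t * w _ t); lia.
Qed.

Lemma mat_addE (A B : mat R) i j : (A + B) i j = A i j + B i j.
Proof. by []. Qed.

Definition laurent_mat (A : mat R) := forall i j, laurent (A i j).

Definition upper (A : mat R) := forall i j, (j < i)%N -> A i j = 0.

Lemma mat_mulE (A B : mat R) i j n : (forall k, (n <= k)%N -> B k j = 0) ->
  mat_mul A B i j = \sum_(k < n) ser_mul (A i k) (B k j).
Proof.
move=> B0; rewrite /mat_mul (fsbigE (iota 0 n)) ?iota_uniq//; last first.
  by move=> k _; rewrite mem_iota/= add0n -leqNgt => /B0->; rewrite ser_mul0r.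
rewrite -[X in iota 0 X]subn0 big_mkord.
by apply: eq_bigl => k; rewrite in_setT.
Qed.

Lemma mat_mul_upper (A B : mat R) i j n : upper B -> (j < n)%N ->
  mat_mul A B i j = \sum_(k < n) ser_mul (A i k) (B k j).
Proof.
by move=> uB jn; apply: mat_mulE => k nk; apply: uB; exact: leq_trans jn nk.
Qed.

Lemma mat_mul1l (A : mat R) : mat_mul (mat_one R) A = A.
Proof.
apply/funext => i; apply/funext => j; rewrite /mat_mul (fsbigE [:: i])//.
  by rewrite big_mkcond big_seq1 in_setT /mat_one eqxx ser_mul1l.
by move=> k _; rewrite inE /mat_one eq_sym => /negPf->; rewrite ser_mul0l.
Qed.

Lemma mat_mul1r (A : mat R) : mat_mul A (mat_one R) = A.
Proof.
apply/funext => i; apply/funext => j; rewrite /mat_mul (fsbigE [:: j])//.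
  by rewrite big_mkcond big_seq1 in_setT /mat_one eqxx ser_mul1r.
by move=> k _; rewrite inE /mat_one => /negPf->; rewrite ser_mul0r.
Qed.

Lemma upper_mul (A B : mat R) : upper A -> upper B -> upper (mat_mul A B).
Proof.
move=> uA uB i j ji; rewrite (mat_mul_upper _ _ uB (ltnSn j)) big1// => k _.
rewrite uA ?ser_mul0l//; exact: leq_trans (ltn_ord k) ji.
Qed.

(** Since the last two factors are upper triangular, all sums are over indices at
    most j, whatever the shape of [A]. *)
Lemma mat_mulA (A B D : mat R) :
  laurent_mat A -> laurent_mat B -> laurent_mat D -> upper B -> upper D ->
  mat_mul (mat_mul A B) D = mat_mul A (mat_mul B D).
Proof.
move=> LA LB LD uB uD; apply/funext => i; apply/funext => j.
rewrite (mat_mul_upper _ _ uD (ltnSn j)).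
rewrite (mat_mul_upper _ _ (upper_mul uB uD) (ltnSn j)).
under eq_bigr => k _.
  rewrite (mat_mul_upper _ _ uB (ltn_ord k)) ser_mul_suml//; last first.
    by move=> x; exact: laurent_mul.
  over.
rewrite exchange_big; apply: eq_bigr => x _.
rewrite (mat_mul_upper _ _ uD (ltnSn j)) ser_mul_sumr//; last first.
  by move=> k; exact: laurent_mul.
by apply: eq_bigr => k _; rewrite ser_mulA.
Qed.

Lemma mat_mul_Lambda_r (X A : mat R) i j :
  laurent_mat X -> laurent_mat A -> upper A ->
  mat_mul X (Lambda R + A) i j =
  X i j.+1 + mat_mul X A i j.
Proof.
move=> LX LA uA; rewrite (mat_mul_upper _ _ uA (ltnSn j)).
have LL k : laurent (Lambda R k j).
  by rewrite /Lambda; case: eqP => _; [exact: laurent1|exact: laurent0].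
rewrite (@mat_mulE _ _ _ _ j.+2) => [|k jk]; last first.
  by rewrite mat_addE /Lambda gtn_eqF// add0r uA// ltnW.
under eq_bigr => k _ do rewrite mat_addE ser_mulDr//.
rewrite big_split/=; congr (_ + _); last first.
  by rewrite big_ord_recr/= uA// ser_mul0r addr0.
rewrite big_ord_recr/= /Lambda eqxx ser_mul1r big1 ?add0r// => k _.
by rewrite ltn_eqF ?ser_mul0r.
Qed.

Lemma mat_mul_Lambda_l (A T : mat R) i j :
  laurent_mat T -> laurent_mat A -> upper T ->
  mat_mul (Lambda R + A) T i.+1 j =
  T i j + mat_mul A T i.+1 j.
Proof.
move=> LT LA uT; have LL k : laurent (Lambda R i.+1 k).
  by rewrite /Lambda; case: eqP => _; [exact: laurent1|exact: laurent0].
rewrite !(mat_mul_upper _ _ uT (ltnSn j)).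
under eq_bigr => k _ do rewrite mat_addE ser_mulDl//.
rewrite big_split/=; congr (_ + _); rewrite /Lambda.
have [ij|ji] := leqP i j; last first.
  rewrite uT// big1// => k _; rewrite eqSS gtn_eqF ?ser_mul0l//.
  exact: leq_trans (ltn_ord k) ji.
rewrite (bigD1 (Ordinal (ij : (i < j.+1)%N)))//= eqxx ser_mul1l.
rewrite big1 ?addr0// => k /eqP ki; rewrite eqSS; case: eqP => [e|_].
  by case: ki; apply: val_inj.
by rewrite ser_mul0l.
Qed.

Lemma mat_mul_Lambda_l0 (A T : mat R) j : upper T ->
  mat_mul (Lambda R + A) T 0 j = mat_mul A T 0 j.
Proof.
move=> uT; rewrite !(mat_mul_upper _ _ uT (ltnSn j)).
by apply: eq_bigr => k _; rewrite mat_addE /Lambda/= add0r.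
Qed.

Lemma mat_mul_companion (u : nat -> series_z R) (T : mat R) i j : upper T ->
  mat_mul (companion_mat u) T i.+1 j = T i j.
Proof.
move=> uT; rewrite (mat_mul_upper _ _ uT (ltnSn j)) /companion_mat.
have [ij|ji] := leqP i j; last first.
  rewrite uT// big1// => k _; rewrite gtn_eqF ?ser_mul0l//.
  exact: leq_trans (ltn_ord k) ji.
rewrite (bigD1 (Ordinal (ij : (i < j.+1)%N)))//= eqxx ser_mul1l.
rewrite big1 ?addr0// => k /eqP ki; case: eqP => [e|_].
  by case: ki; apply: val_inj.
by rewrite ser_mul0l.
Qed.

Lemma A0_laurent_laurent u : A0_laurent l u -> laurent u.
Proof. by move=> [_ [M /laurent_bound]]. Qed.

Lemma A0_coef_mul u v m : laurent u -> laurent v ->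
  (forall a, A0 l (u a)) -> (forall a, A0 l (v a)) -> A0 l (ser_mul u v m).
Proof.
move=> [K uK] [K' vK] uA vA; pose lo := m - K'%:Z; pose n := (K + `|lo|%N).+1.
rewrite (_ : ser_mul u v m = fun t => \sum_(k < n)
    u (lo + k%:Z) t * v (m - (lo + k%:Z)) t).
  by apply: A0_sum => k _; apply: A0_mul.
by apply/funext => t; apply: (ser_mulE _ uK vK); lia.
Qed.

Lemma A0_laurentP u : laurent u -> (forall a, A0 l (u a)) -> A0_laurent l u.
Proof. by move=> [K uK] uA; split=> //; exists K%:Z. Qed.

Lemma A0_laurent_mul u v :
  A0_laurent l u -> A0_laurent l v -> A0_laurent l (ser_mul u v).
Proof.
move=> uA vA; have Lu := A0_laurent_laurent uA; have Lv := A0_laurent_laurent vA.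
apply: A0_laurentP; first exact: laurent_mul.
by move=> m; apply: A0_coef_mul => //; [case: uA|case: vA].
Qed.

Lemma A0_laurentD u v :
  A0_laurent l u -> A0_laurent l v -> A0_laurent l (u + v).
Proof.
move=> uA vA; have Lu := A0_laurent_laurent uA; have Lv := A0_laurent_laurent vA.
apply: A0_laurentP; first exact: laurentD.
by move=> m; apply: A0_add; [case: uA|case: vA].
Qed.

Lemma A0_laurent_sum (I : Type) (r : seq I) (F : I -> series_z R) :
  (forall i, A0_laurent l (F i)) -> A0_laurent l (\sum_(i <- r) F i).
Proof.
move=> H; elim/big_rec: _ => [|i u _]; last exact: A0_laurentD.
by apply: A0_laurentP; [exact: laurent0|move=> a; exact: A0_0].
Qed.

End Series.

(** * Regularity, diagonal by diagonal *)

Section RegularDiagonals.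
Variables (R : realType) (l : R[i]%C).
Local Notation C := (R[i]%C).
Implicit Types (x y : nat -> series_z R) (N d : nat).

(** The part of the definition of [Lgl_q] that concerns the sequence [x] of
    entries on the [d]-th diagonal. The bound [N] does not depend on the power
    [m], nor the bound on the powers on the row [i]: so each coefficient of a
    product is a finite sum, with the same number of terms in all rows. *)
Definition regular_diag N d x : Prop :=
  [/\ forall i m, A0 l (x i m),
      forall m, exists2 f, A0_2 l f &
        forall i : nat, (N < i)%N -> forall t, x i m t = f i%:R t,
      forall m (p i : nat), (N < i)%N -> (i < p)%N -> (p <= i + d)%N ->
        x i m p%:R = 0
    & exists K : nat, forall m : int, K%:Z < m -> forall i, x i m = 0].

Definition diag (A : mat R) d : nat -> series_z R := fun i => A i (i + d)%N.

Lemma regular_diag_laurent N d x : regular_diag N d x -> forall i, laurent (x i).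
Proof. by move=> [_ _ _ [K xK]] i; exists K => m /xK. Qed.

Lemma regular_diag_A0 N d x : regular_diag N d x ->
  forall i, A0_laurent l (x i).
Proof.
move=> xP i; apply: A0_laurentP; first exact: regular_diag_laurent xP i.
by case: xP.
Qed.

Lemma regular_diag0 N d : regular_diag N d (fun=> 0).
Proof.
split=> [i m|m|//|]; first exact: A0_0.
- by exists 0; first exact: A0_2_0.
- by exists 0%N.
Qed.

Lemma regular_diag1 N : regular_diag N 0 (fun=> ser_one R).
Proof.
have A1 m : A0 l (ser_one R m).
  by rewrite /ser_one; case: eqP => _; exact: A0_cst.
split=> [i m|m|m p i _ ip|]; first exact: A1.
- by exists (fun _ => ser_one R m); first exact/A0_2_r/A1.
- by rewrite addn0 leqNgt ip.
- by have [K H] := laurent1 R; exists K => m /H.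
Qed.

Lemma regular_diagD N d x y : regular_diag N d x -> regular_diag N d y ->
  regular_diag N d (fun i => x i + y i).
Proof.
move=> [xA xf x0 [K xK]] [yA yf y0 [K' yK]]; split.
- by move=> i m; apply: A0_add.
- move=> m; have [f fA xE] := xf m; have [g gA yE] := yf m.
  exists (fun w t => f w t + g w t); first exact: A0_2_add.
  by move=> i Ni t; rewrite ser_addE xE// yE.
- by move=> m p i Ni ip pd; rewrite ser_addE x0// y0// addr0.
- exists (K + K')%N => m Km i; apply/funext => t.
  rewrite ser_addE xK ?yK ?addr0//; lia.
Qed.

Lemma regular_diag_scale N d (c : int -> C) x : regular_diag N d x ->
  regular_diag N d (fun i m t => c m * x i m t).
Proof.
move=> [xA xf x0 [K xK]]; split.
- by move=> i m; apply: A0_scale.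
- move=> m; have [f fA xE] := xf m.
  exists (fun w t => c m * f w t); last by move=> i Ni t; rewrite xE.
  by apply: A0_2_mul => //; apply/A0_2_r/A0_cst.
- by move=> m p i Ni ip pd; rewrite x0// mulr0.
- by exists K => m Km i; apply/funext => t; rewrite xK// mulr0.
Qed.

Lemma regular_diagN N d x : regular_diag N d x ->
  regular_diag N d (fun i => - x i).
Proof.
move=> /(regular_diag_scale (fun=> -1)).
congr (regular_diag _ _ _); apply/funext => i; apply/funext => m.
by apply/funext => t; rewrite mulN1r.
Qed.

Lemma regular_diag_sum N d (I : Type) (r : seq I) (F : I -> nat -> series_z R) :
  (forall k, regular_diag N d (F k)) ->
  regular_diag N d (fun i => \sum_(k <- r) F k i).
Proof.
move=> HF; elim: r => [|k r IHr].
  by under eq_fun do rewrite big_nil; exact: regular_diag0.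
by under eq_fun do rewrite big_cons; exact: regular_diagD.
Qed.

(** The vanishing condition survives products because of triangularity: in
    A_(i,k) B_(k,j) with N < i < p <= j, either p <= k and the first factor
    vanishes at p, or i <= k < p and the second one does. *)
Lemma regular_diag_mul N d e x y : regular_diag N d x -> regular_diag N e y ->
  regular_diag N (d + e) (fun i => ser_mul (x i) (y (i + d)%N)).
Proof.
move=> xP yP; have xL := regular_diag_laurent xP.
have yL := regular_diag_laurent yP.
case: xP yP => [xA xf x0 [K xK]] [yA yf y0 [K' yK]].
have mulE i m t : ser_mul (x i) (y (i + d)%N) m t =
    \sum_(k < (K + `|m - K'%:Z|).+1) x i (m - K'%:Z + k%:Z) t
      * y (i + d)%N (m - (m - K'%:Z + k%:Z)) t.
  apply: (@ser_mulE _ _ _ K K'); [by move=> a /xK|by move=> a /yK|lia..].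
split.
- by move=> i m; apply: A0_coef_mul.
- move=> m; have /choice[f fP] : forall a, exists f, A0_2 l f /\
      forall i : nat, (N < i)%N -> forall t, x i a t = f i%:R t.
    by move=> a; have [f ? ?] := xf a; exists f.
  have /choice[g gP] : forall a, exists g, A0_2 l g /\
      forall i : nat, (N < i)%N -> forall t, y i a t = g i%:R t.
    by move=> a; have [g ? ?] := yf a; exists g.
  exists (fun w t => \sum_(k < (K + `|m - K'%:Z|).+1)
      f (m - K'%:Z + k%:Z) w t * g (m - (m - K'%:Z + k%:Z)) (w + d%:R) t).
    apply: A0_2_sum => k; apply: A0_2_mul; first by case: (fP (m - K'%:Z + k%:Z)).
    by apply: A0_2_shift; case: (gP (m - (m - K'%:Z + k%:Z))).
  move=> i Ni t; rewrite mulE; apply: eq_bigr => k _.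
  have [_ ->//] := fP (m - K'%:Z + k%:Z).
  have [_ ->] := gP (m - (m - K'%:Z + k%:Z)); last by rewrite ltn_addr.
  by rewrite natrD.
- move=> m p i Ni ip pde; rewrite mulE big1// => k _.
  have [pd|dp] := leqP p (i + d)%N; first by rewrite x0// mul0r.
  by rewrite (y0 _ p)// ?mulr0// -?addnA// ltn_addr.
- exists (K + K')%N => m Km i; apply/funext => t.
  rewrite (@ser_mulE _ _ _ K K' (m - K'%:Z) m 0) ?big_ord0//;
    [by move=> a /xK|by move=> a /yK|lia..].
Qed.

Lemma regular_diag_weaken N N' d x : (N <= N')%N ->
  regular_diag N d x -> regular_diag N' d x.
Proof.
move=> NN [xA xf x0 xK]; split=> //.
  move=> m; have [f fA xE] := xf m; exists f => // i N'i.
  by apply: xE; exact: leq_ltn_trans N'i.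
by move=> m p i N'i; apply: x0; exact: leq_ltn_trans N'i.
Qed.

Lemma regular_for_weaken (A : nat -> nat -> C -> C) (N N' : int) : N <= N' ->
  regular_for l A N -> regular_for l A N'.
Proof.
move=> NN [A1 A2 A3]; split.
- by move=> i j n ij n_lt; apply: (A1 _ _ n) => //; lia.
- move=> n N'n; have [Nn|nN] := leP (- N) n.
    have [f [fA fE]] := A2 _ Nn; exists f; split=> // i j ij N'i.
    by apply: fE; lia.
  exists 0; split; first exact: A0_2_0.
  by move=> i j ij N'i t; rewrite (A1 _ _ n).
- by move=> m N'm i j N'i im mj; apply: A3 => //; lia.
Qed.

(** The degree is an infimum of integers, perhaps equal to -oo; the next integer
    is above a value that is attained. *)
Lemma regular_for_reg (A : nat -> nat -> C -> C) (N : int) :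
  (reg l A <= (N%:~R)%:E)%E -> regular_for l A (N + 1).
Proof.
move=> AN; have : (reg l A < ((N + 1)%:~R)%:E)%E.
  by apply: le_lt_trans AN _; rewrite lte_fin ltr_int; lia.
move=> /ereal_inf_lt[_ [M /= AM <-]]; rewrite lte_fin ltr_int => MN.
by apply: regular_for_weaken AM; exact: ltW.
Qed.

(** All the conditions defining [Lb_plus] can be checked on each diagonal
    separately, except that [N] has to be common to all diagonals. *)
Lemma Lb_plusP (A : mat R) : Lb_plus l A <->
  upper A /\ exists N, forall d, regular_diag N d (diag A d).
Proof.
split=> [[[[AA _] _ [N AN] AM] uA]|[uA [N AN]]].
  split=> //; exists `|(N + 1)%R|%N => d.
  have rA m : regular_for l (coef_z A m) `|(N + 1)%R|%N.
    by apply: regular_for_weaken (regular_for_reg (AN m)); lia.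
  split.
  - by move=> i m; have [+ _] := AA i (i + d)%N; apply.
  - move=> m; have [_ A2 _] := rA m.
    have [|f [fA fE]] := A2 d%:Z; first lia.
    exists f => // i Ni t; apply: fE; lia.
  - move=> m p i Ni ip pd; have [_ _ A3] := rA m.
    by apply: (A3 p%:Z); lia.
  - have [M MA] := AM d%:Z; exists `|M|%N => m Mm i.
    by apply: (MA m); lia.
have AE i j : (i <= j)%N -> A i j = diag A (j - i) i.
  by move=> ij; rewrite /diag subnKC.
have Adiag (i j : nat) (d : nat) : j%:Z = i%:Z + d%:Z -> A i j = diag A d i.
  by move=> e; rewrite /diag; congr (A i _); lia.
have AA i j : A0_laurent l (A i j).
  have [ij|ji] := leqP i j.
    by rewrite AE//; exact: regular_diag_A0 (AN _) _.
  by rewrite uA//; apply: A0_laurentP; [exact: laurent0|move=> a; exact: A0_0].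
have rA m : regular_for l (coef_z A m) N.
  split.
  - by move=> i j n ij nN; rewrite /coef_z uA//; lia.
  - move=> [d|d] dN; last first.
      exists 0; split; first exact: A0_2_0.
      by move=> i j ij Ni t; rewrite /coef_z uA//; lia.
    have [_ Af _ _] := AN d; have [f fA fE] := Af m.
    exists f; split=> // i j ij Ni t.
    by rewrite /coef_z (Adiag _ _ _ ij) fE//; lia.
  - move=> [p|//] Np i j Ni ip pj; rewrite /coef_z AE; last by lia.
    by have [_ _ -> //] := AN (j - i)%N; lia.
split=> //; split.
- by split=> //; exists 0 => i j ij; apply: uA; lia.
- move=> m; split; last by exists N%:Z.
  split; first by move=> i j; have [+ _] := AA i j; apply.
  by exists 0 => i j ij; rewrite /coef_z uA//; lia.
- exists N%:Z => m; apply: ereal_inf_lbound; exists N%:Z => //; exact: rA.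
- move=> [d|d]; last first.
    by exists 0 => m _ i j ij; rewrite /coef_z uA//; lia.
  have [_ _ _ [K AK]] := AN d; exists K%:Z => m Km i j ij.
  by rewrite /coef_z (Adiag _ _ _ ij) AK.
Qed.

Lemma LN_plusP (T : mat R) : LN_plus l T <->
  [/\ upper T, forall i, T i i = ser_one R &
      exists N, forall d, regular_diag N d (diag T d)].
Proof.
split=> [[S [SL S0] <-]|[uT T1 [N TN]]].
  have [|uS [N SN]] := (Lb_plusP S).1.
    by split=> // i j ij; apply: S0; exact: ltnW.
  split=> [i j ji|i|].
  - by rewrite mat_addE /mat_one gtn_eqF// uS// addr0.
  - by rewrite mat_addE /mat_one eqxx S0// addr0.
  - exists N => -[|d].
      rewrite (_ : diag _ 0 = fun=> ser_one R); first exact: regular_diag1.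
      by apply/funext => i; rewrite /diag addn0 mat_addE /mat_one eqxx S0// addr0.
    rewrite (_ : diag _ d.+1 = diag S d.+1) => //.
    apply/funext => i; rewrite /diag mat_addE /mat_one ltn_eqF ?add0r//; lia.
exists (T - mat_one R); last by rewrite addrC subrK.
suff [SL uS] : Lb_plus l (T - mat_one R).
  split=> // i j; rewrite leq_eqVlt => /orP[/eqP->|/uS//].
  by rewrite [LHS]mat_addE T1 [X in _ + X]/(- mat_one R i i) /mat_one eqxx subrr.
apply/Lb_plusP; split=> [i j ji|].
  rewrite [LHS]mat_addE uT// [X in _ + X]/(- mat_one R i j) /mat_one gtn_eqF//.
  by rewrite subr0.
exists N => -[|d].
  rewrite (_ : diag _ 0 = fun=> 0); first exact: regular_diag0.
  apply/funext => i; rewrite /diag addn0 [LHS]mat_addE T1.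
  by rewrite [X in _ + X]/(- mat_one R i i) /mat_one eqxx subrr.
rewrite (_ : diag _ d.+1 = diag T d.+1) => //.
apply/funext => i; rewrite /diag mat_addE.
rewrite [X in _ + X]/(- mat_one R i (i + d.+1)%N) /mat_one ltn_eqF ?subr0//; lia.
Qed.

Lemma regular_laurent_mat (A : mat R) N : upper A ->
  (forall d, regular_diag N d (diag A d)) -> laurent_mat A.
Proof.
move=> uA AN i j; have [ij|ji] := leqP i j; last by rewrite uA//; exact: laurent0.
by have := regular_diag_laurent (AN (j - i)%N) i; rewrite /diag subnKC.
Qed.

End RegularDiagonals.

(** * Inverses of unitriangular matrices *)

(** Diagonals are constructed one after the other: [x d] is chosen subject to a
    condition that involves [x e] for e < d only. *)
Lemma strong_choice (X : Type) (x0 : X) (P : nat -> (nat -> X) -> X -> Prop) :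
  (forall d y y' z, (forall e, (e < d)%N -> y e = y' e) ->
    P d y z -> P d y' z) ->
  (forall d y, (forall e, (e < d)%N -> P e y (y e)) -> exists z, P d y z) ->
  exists x, forall d, P d x (x d).
Proof.
move=> Ploc Pex.
have /choice[F FP] : forall dy : nat * (nat -> X), exists z,
    (forall e, (e < dy.1)%N -> P e dy.2 (dy.2 e)) -> P dy.1 dy.2 z.
  move=> [d y] /=; 
  have [/Pex[z Pz]|nP] := pselect (forall e, (e < d)%N -> P e y (y e)).
    by exists z.
  by exists x0.
pose fix g d : nat -> X := if d is d'.+1 then
  (fun e => if e == d' then F (d', g d') else g d' e) else fun=> x0.
have gE d e : (e < d)%N -> g d e = g e.+1 e.
  elim: d => // d IHd; rewrite ltnS leq_eqVlt => /orP[/eqP->//|ed].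
  by rewrite [LHS]/= ltn_eqF// IHd.
exists (fun d => g d.+1 d); elim/ltn_ind => d IHd.
apply: (Ploc _ (g d)) => [e ed|]; first exact: gE.
rewrite /= eqxx; apply: (FP (d, g d)) => /= e ed.
rewrite gE//; apply: Ploc (IHd e ed) => k ke.
by rewrite gE//; exact: ltn_trans ed.
Qed.

Section InverseMatrix.
Variables (R : realType) (l : R[i]%C).
Local Notation C := (R[i]%C).

Definition mat_of_diags (X : nat -> nat -> series_z R) : mat R :=
  fun i j => if (i <= j)%N then X (j - i)%N i else 0.

Lemma upper_mat_of_diags X : upper (mat_of_diags X).
Proof. by move=> i j ji; rewrite /mat_of_diags leqNgt ji. Qed.

Lemma diag_mat_of_diags X d : diag (mat_of_diags X) d = X d.
Proof.
by apply/funext => i; rewrite /diag /mat_of_diags leq_addr addKn.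
Qed.

Lemma diag_mul (A B : mat R) d i : upper A -> upper B ->
  diag (mat_mul A B) d i =
  \sum_(e < d.+1) ser_mul (diag A e i) (diag B (d - e) (i + e)%N).
Proof.
move=> uA uB; rewrite /diag (@mat_mul_upper _ _ _ _ _ (i + d.+1)%N)//; last by lia.
rewrite big_split_ord/= big1 ?add0r => [|k _]; last by rewrite uA ?ser_mul0l.
apply: eq_bigr => e _; congr (ser_mul _ (B _ _)).
by rewrite -addnA subnKC// -ltnS.
Qed.


(** The [d]-th diagonal of T U = 1 expresses the [d]-th diagonal of [U] through
    the previous ones, by products that keep the regularity bound of [T]. *)
Lemma LN_plus_right_inverse (T : mat R) : LN_plus l T ->
  exists2 U, LN_plus l U & mat_mul T U = mat_one R.
Proof.
move=> /LN_plusP[uT T1 [N TN]].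
(* The contribution of the entries of [T] above its diagonal. *)
pose tail (y : nat -> nat -> series_z R) d i : series_z R :=
  \sum_(e < d) ser_mul (diag T e.+1 i) (y (d - e.+1)%N (i + e.+1)%N).
have [||x xP] := @strong_choice (nat -> series_z R) (fun=> 0)
  (fun d y z => regular_diag l N d z /\
     forall i, z i = (if d == 0%N then ser_one R else 0) - tail y d i).
- move=> d y y' z yy' [zN zE]; split=> // i; rewrite zE; congr (_ - _).
  apply: eq_bigr => e _; rewrite yy'//; have := ltn_ord e; lia.
- move=> d y yP; exists (fun i => (if d == 0%N then ser_one R else 0) - tail y d i).
  split=> //; apply: regular_diagD.
    by case: eqP => [->|_]; [exact: regular_diag1|exact: regular_diag0].
  apply/regular_diagN/regular_diag_sum => e.
  have {1}-> : d = (e.+1 + (d - e.+1))%N by rewrite subnKC.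
  apply: regular_diag_mul => //; have [] // := yP (d - e.+1)%N.
  have := ltn_ord e; lia.
pose U := mat_of_diags x; have uU : upper U := upper_mat_of_diags _.
have x0 i : x 0 i = ser_one R by have [_ ->] := xP 0; rewrite /tail big_ord0 subr0.
exists U.
  apply/LN_plusP; split=> // [i|]; first by rewrite /U /mat_of_diags leqnn subnn x0.
  by exists N => d; rewrite diag_mat_of_diags; have [] := xP d.
apply/funext => i; apply/funext => j; have [ij|ji] := leqP i j; last first.
  by rewrite upper_mul// /mat_one gtn_eqF.
rewrite -(subnKC ij); move: (j - i)%N => {ij}d.
rewrite -[LHS]/(diag (mat_mul T U) d i) diag_mul// big_ord_recl /= subn0.
rewrite /diag addn0 T1 ser_mul1l -/(diag U d i) diag_mat_of_diags.
have [_ ->] := xP d; rewrite -/(tail x d i).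
rewrite /mat_one (_ : (i == i + d)%N = (d == 0)%N); last by lia.
rewrite (_ : \sum_(_ < _) _ = tail x d i) ?subrK//.
apply: eq_bigr => e _.
by rewrite -[X in ser_mul _ X]/(diag U (d - e.+1) _) diag_mat_of_diags.
Qed.

Lemma LN_plus_laurent (T : mat R) : LN_plus l T -> laurent_mat T.
Proof. by move=> /LN_plusP[uT _ [N]]; exact: regular_laurent_mat. Qed.

Lemma LN_plus_upper (T : mat R) : LN_plus l T -> upper T.
Proof. by move=> /LN_plusP[]. Qed.

(** Right inverses are enough: if T U = 1 and U V = 1, then
    T = T (U V) = (T U) V = V. *)
Lemma LN_invP (T : mat R) : LN_plus l T ->
  [/\ LN_plus l (LN_inv l T), mat_mul T (LN_inv l T) = mat_one R
    & mat_mul (LN_inv l T) T = mat_one R].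
Proof.
move=> TN; rewrite /LN_inv.
suff : exists S, [/\ LN_plus l S, mat_mul T S = mat_one R
                    & mat_mul S T = mat_one R] by exact: xgetPex.
have [U UN TU] := LN_plus_right_inverse TN; exists U; split=> //.
have [V VN UV] := LN_plus_right_inverse UN.
have /LN_plus_laurent LT := TN; have /LN_plus_laurent LU := UN.
have /LN_plus_laurent LV := VN.
suff -> : T = V by [].
rewrite -[T]mat_mul1r -UV -mat_mulA//; [|exact: LN_plus_upper..].
by rewrite TU mat_mul1l.
Qed.

(** This reduces statements on the gauge action to equations that are linear in
    [T]. *)
Lemma gauge_mulr (q : C) (T L : mat R) : LN_plus l T ->
  laurent_mat (mat_mul (h_shift q T) L) ->
  mat_mul (h_shift q T) L = mat_mul (gauge q l T L) T.
Proof.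
move=> TN LX; have [UN _ UT] := LN_invP TN.
rewrite /gauge mat_mulA ?UT ?mat_mul1r//; first exact: LN_plus_laurent UN.
- exact: LN_plus_laurent TN.
- exact: LN_plus_upper UN.
- exact: LN_plus_upper TN.
Qed.

End InverseMatrix.

(** * The gauge action *)

Section GaugeAction.
Variables (R : realType) (q l : R[i]%C).
Local Notation C := (R[i]%C).

(** On the coefficient of z^m, the equation for one diagonal of the normalizing
    matrix is y_i(t) = q^m y_(i+1)(t) + P_(i+1)(t). For i > N, where
    P_i(t) = g(i, t), a solution f(i, t) exists in the tensor square of A_0, and
    q^(-mi) c(t) can be added to it for any c in A_0. The regularity condition
    contains y_(p-1)(p) = 0, which forces c(t) = - q^(m (t - 1)) f(t - 1, t): again
    an element of A_0. The other vanishing conditions follow, because P_(i+1)(p)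
    vanishes for N < i < p - 1; the rows i <= N are then given by descending
    recursion from row N + 1. *)
Lemma gauge_step_coef N d (m : int) (P : nat -> C -> C) :
  q != 0 -> cexp l = q -> (forall i, A0 l (P i)) ->
  (exists2 f, A0_2 l f & forall i : nat, (N < i)%N -> forall t, P i t = f i%:R t) ->
  (forall p i : nat, (N < i)%N -> (i < p)%N -> (p <= i + d)%N -> P i p%:R = 0) ->
  exists y : nat -> C -> C,
    [/\ forall i, A0 l (y i),
        exists2 f, A0_2 l f &
          forall i : nat, (N < i)%N -> forall t, y i t = f i%:R t,
        forall p i : nat, (N < i)%N -> (i < p)%N -> (p <= i + d.+1)%N ->
          y i p%:R = 0
      & forall i t, y i t = q ^ m * y i.+1 t + P i.+1 t].
Proof.
move=> q_neq0 lE PA [g gA gE] P0.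
have [f fA fE] := A0_2_diff_surj (q ^ m) (A0_2_shift 1 gA).
pose F w t := f w t - qpow l (- m%:~R * w) *
  (qpow l (m%:~R * (t - 1)) * f (t - 1) t).
have FA : A0_2 l F.
  rewrite (_ : F = fun w t => f w t + qpow l ((- m)%:~R * w) *
      (-1 * (qpow l (m%:~R * (t - 1)) * f (t - 1) t))).
    apply: A0_2_add => //; apply: A0_2_prod; first exact: A0_qpow.
    apply/A0_scale/A0_mul; last exact: A0_2_diag.
    exact: (A0_shift (- 1) (A0_qpow l m)).
  by apply/funext => w; apply/funext => t; rewrite /F mulrNz; ring.
have FE w t : F w t = q ^ m * F (w + 1) t + g (w + 1) t.
  rewrite -fE /F; set b := qpow l (m%:~R * (t - 1)) * _.
  rewrite (mulrDr (- m%:~R)) mulr1 qpowD.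
  rewrite -[X in _ * qpow l X]mulrNz (qpow_int _ lE) -invr_expz.
  have qm0 : q ^ m != 0 by rewrite expfz_neq0.
  field.
  exact: qm0.
have F0 (p : nat) : F (p%:R) p.+1%:R = 0.
  rewrite /F -natr1 addrK mulrA -qpowD mulNr addNr qpow0 mul1r; exact: subrr.
(* [z k] is the solution in row N + 1 - k. *)
pose fix z k : C -> C := if k is k'.+1 then
  (fun t => q ^ m * z k' t + P (N.+1 - k')%N t) else F N.+1%:R.
exists (fun i => if (N < i)%N then F i%:R else z (N.+1 - i)%N); split.
- move=> i; case: ifP => _; first exact: A0_2_fst.
  elim: (_ - _)%N => [|k IHk]; first exact: A0_2_fst.
  by apply: A0_add => //; exact: A0_scale.
- by exists F => // i ->.
- move=> p i Ni ip; rewrite addnS => pid.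
  have [n pE] : exists n, p = (i + n).+1 by exists (p - i).-1; lia.
  elim: n i Ni ip pid pE => [|n IHn] i Ni ip pid pE.
    by rewrite Ni pE addn0 F0.
  rewrite Ni FE natr1 -gE; last by lia.
  rewrite P0 ?addr0; [|lia..].
  have := IHn i.+1; rewrite ifT; last by lia.
  by move=> ->; rewrite ?mulr0//; lia.
- move=> i t; have [Ni|iN] := ltnP N i.
    by rewrite (leqW Ni) FE natr1 -gE ?leqW.
  rewrite subSn//=.
  have -> : (N.+1 - (N - i))%N = i.+1 by lia.
  congr (_ * _ + _); case: ifP => Ni.
    by rewrite (_ : i = N) ?subnn//; lia.
  by congr (z _ _); lia.
Qed.

Lemma gauge_step N d (P : nat -> series_z R) :
  q != 0 -> cexp l = q -> regular_diag l N d P ->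
  exists y, regular_diag l N d.+1 y /\
    forall i m t, y i m t = q ^ m * y i.+1 m t + P i.+1 m t.
Proof.
move=> q_neq0 lE [PA Pf P0 [K PK]].
have /choice[y yP] : forall m : int, exists y : nat -> C -> C,
    [/\ forall i, A0 l (y i),
        exists2 f, A0_2 l f &
          forall i : nat, (N < i)%N -> forall t, y i t = f i%:R t,
        forall p i : nat, (N < i)%N -> (i < p)%N -> (p <= i + d.+1)%N ->
          y i p%:R = 0
      & forall i t, y i t = q ^ m * y i.+1 t + P i.+1 m t] /\
    (K%:Z < m -> y = 0).
  move=> m; have [Km|mK] := ltP K%:Z m.
    exists 0; split=> //; split=> // [i||i t]; first exact: A0_0.
      by exists 0; first exact: A0_2_0.
    by rewrite PK// [RHS]addr0 [RHS]mulr0.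
  have [y yP] := gauge_step_coef m q_neq0 lE (fun i => PA i m) (Pf m) (P0 m).
  by exists y; split=> //; rewrite ltNge mK.
exists (fun i m => y m i); split; last by move=> i m t; have [[_ _ _]] := yP m.
split.
- by move=> i m; have [[+ _ _ _] _] := yP m; apply.
- by move=> m; have [[_ + _ _] _] := yP m.
- by move=> m; have [[_ _ + _] _] := yP m.
- by exists K => m Km i; have [_ ->] := yP m.
Qed.

Lemma upper_ext (A B : mat R) : upper A -> upper B ->
  (forall d, diag A d = diag B d) -> A = B.
Proof.
move=> uA uB AB; apply/funext => i; apply/funext => j.
have [ij|ji] := leqP i j; last by rewrite uA ?uB.
by have /(congr1 (fun x => x i)) := AB (j - i)%N; rewrite /diag subnKC.
Qed.

Lemma diag_mul_eql (A B D : mat R) d : upper A -> upper B -> upper D ->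
  (forall e, (e <= d)%N -> diag A e = diag B e) ->
  diag (mat_mul A D) d = diag (mat_mul B D) d.
Proof.
move=> uA uB uD AB; apply/funext => i; rewrite !diag_mul//.
by apply: eq_bigr => e _; rewrite AB// -ltnS.
Qed.

Lemma diag_mul_eqr (A B D : mat R) d : upper A -> upper B -> upper D ->
  (forall e, (e <= d)%N -> diag A e = diag B e) ->
  diag (mat_mul D A) d = diag (mat_mul D B) d.
Proof.
move=> uA uB uD AB; apply/funext => i; rewrite !diag_mul//.
by apply: eq_bigr => e _; rewrite AB// leq_subr.
Qed.

Lemma upper_h_shift (T : mat R) : upper T -> upper (h_shift q T).
Proof.
move=> uT i j ji; apply/funext => m; apply/funext => t.
by rewrite /h_shift uT// mulr0.
Qed.

Lemma h_shift_one (T : mat R) i : T i i = ser_one R ->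
  h_shift q T i i = ser_one R.
Proof.
move=> T1; apply/funext => m; apply/funext => t; rewrite /h_shift T1 /ser_one.
by case: eqP => [->|_]; rewrite ?mulr1 ?expr0z// mulr0.
Qed.

Lemma h_shift1 : h_shift q (mat_one R) = mat_one R.
Proof.
apply/funext => i; apply/funext => j; apply/funext => m; apply/funext => t.
rewrite /h_shift /mat_one /ser_one; case: (i == j); last exact: mulr0.
by case: eqP => [->|_]; rewrite ?mulr1 ?expr0z// mulr0.
Qed.

Lemma diag_h_shift_eq (A B : mat R) d : diag A d = diag B d ->
  diag (h_shift q A) d = diag (h_shift q B) d.
Proof.
move=> AB; apply/funext => i; apply/funext => m; apply/funext => t.
by rewrite /diag /h_shift -/(diag A d i) -/(diag B d i) AB.
Qed.

Lemma regular_diag_h_shift N d (T : mat R) : regular_diag l N d (diag T d) ->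
  regular_diag l N d (diag (h_shift q T) d).
Proof. exact: regular_diag_scale. Qed.

Lemma upper1 : upper (mat_one R).
Proof. by move=> i j ji; rewrite /mat_one gtn_eqF. Qed.

Lemma LN_plus_laurent_h (T : mat R) : LN_plus l T -> laurent_mat (h_shift q T).
Proof.
move=> /LN_plusP[uT _ [N TN]]; apply: (@regular_laurent_mat _ l _ N).
  exact: upper_h_shift.
by move=> d; apply: regular_diag_h_shift.
Qed.

Lemma Lb_plus_laurent (A : mat R) : Lb_plus l A -> laurent_mat A.
Proof. by move=> /Lb_plusP[uA [N]]; exact: regular_laurent_mat. Qed.

Lemma gauge_row_step (T A : mat R) d i : LN_plus l T -> Lb_plus l A ->
  mat_mul (h_shift q T) (Lambda R + A) i (i + d)%N =
  diag (h_shift q T) d.+1 i + diag (mat_mul (h_shift q T) A) d i.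
Proof.
move=> TN AB; rewrite mat_mul_Lambda_r; last by case: AB => _ uA.
- by rewrite /diag addnS.
- exact: LN_plus_laurent_h.
- exact: Lb_plus_laurent.
Qed.

Lemma LN_plus_diag0 (T : mat R) : LN_plus l T -> diag T 0 = fun=> ser_one R.
Proof. by move=> /LN_plusP[_ T1 _]; apply/funext => i; rewrite /diag addn0. Qed.

(** On diagonal d + 1, once [T] agrees with 1 on the previous ones, the products
    with [A] cancel in (hT)(Lambda + A) = (Lambda + A) T. What remains is
    hT_(0,d+1) = 0 in the first row, and then
    hT_(i+1,i+d+2) = T_(i,i+d+1) down the diagonal. *)
Lemma gauge_free (T A : mat R) : q != 0 -> LN_plus l T -> Lb_plus l A ->
  mat_mul (h_shift q T) (Lambda R + A) = mat_mul (Lambda R + A) T ->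
  T = mat_one R.
Proof.
move=> q_neq0 TN AB comm; have uT := LN_plus_upper TN.
have uA : upper A by case: AB.
have uhT := upper_h_shift uT.
apply: upper_ext => //; first exact: upper1.
elim/ltn_ind => -[_|d IHd].
  rewrite LN_plus_diag0//; apply/funext => i.
  by rewrite /diag /mat_one addn0 eqxx.
have hTA : diag (mat_mul (h_shift q T) A) d = diag A d.
  rewrite (@diag_mul_eql _ (mat_one R))// ?mat_mul1l//; first exact: upper1.
  by move=> e ed; rewrite -h_shift1; apply/diag_h_shift_eq/IHd.
have AT : diag (mat_mul A T) d = diag A d.
  rewrite (@diag_mul_eqr _ (mat_one R))// ?mat_mul1r//; exact: upper1.
have T0 m t : diag T d.+1 0 m t = 0.
  have := gauge_row_step d 0 TN AB; rewrite comm add0n mat_mul_Lambda_l0//.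
  rewrite -[LHS]/(diag (mat_mul A T) d 0) hTA AT -[LHS]add0r.
  move=> /addIr/(congr1 (fun u => u m t))/esym/eqP.
  by rewrite mulf_eq0 expfz_eq0 (negPf q_neq0) andbF => /eqP.
apply/funext => i; apply/funext => m; apply/funext => t.
rewrite [RHS](_ : _ = 0); last by rewrite /diag /mat_one ltn_eqF//; lia.
elim: i => // i IHi.
have := gauge_row_step d i.+1 TN AB; rewrite comm mat_mul_Lambda_l//.
- rewrite -[mat_mul A T _ _]/(diag (mat_mul A T) d i.+1) hTA AT.
  move=> /addIr/(congr1 (fun u => u m t)).
  rewrite addSnnS -[T i _]/(diag T d.+1 i) IHi => /esym/eqP.
  by rewrite mulf_eq0 expfz_eq0 (negPf q_neq0) andbF => /eqP.
- exact: LN_plus_laurent TN.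
- exact: Lb_plus_laurent.
Qed.

(** The solution [T] is built diagonal by diagonal. On diagonal d + 1 the equation
    is the one of [gauge_step], with inhomogeneous term the [d]-th diagonal of
    (hT) A, which involves the diagonals of [T] up to [d] only. *)
Lemma gauge_normalizer_exists (A : mat R) :
  q != 0 -> cexp l = q -> Lb_plus l A ->
  exists2 T, LN_plus l T &
    forall i j, mat_mul (h_shift q T) (Lambda R + A) i.+1 j = T i j.
Proof.
move=> q_neq0 lE AB; have [uA [N AN]] := (Lb_plusP l A).1 AB.
pose h (u : series_z R) : series_z R := fun m t => q ^ m * u m t.
pose W (y : nat -> nat -> series_z R) d i : series_z R :=
  \sum_(e < d.+1) ser_mul (h (y e i)) (diag A (d - e) (i + e)%N).
have [||x xP] := @strong_choice (nat -> series_z R) (fun=> 0)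
  (fun d y z => regular_diag l N d z /\
     if d is d'.+1
     then forall i m t, z i m t = q ^ m * z i.+1 m t + W y d' i.+1 m t
     else z = fun=> ser_one R).
- move=> [|d] y y' z yy' [zN zE]; split=> // i m t; rewrite zE; congr (_ + _ m t).
  by apply: eq_bigr => e _; rewrite yy'.
- move=> [|d] y yP.
    by exists (fun=> ser_one R); split=> //; exact: regular_diag1.
  apply: gauge_step => //; apply: regular_diag_sum => e.
  have {1}-> : d = (e + (d - e))%N by rewrite subnKC// -ltnS.
  apply: regular_diag_mul => //; have [yN _] := yP e (ltn_ord e).
  exact: regular_diag_scale.
pose T := mat_of_diags x; have uT : upper T := upper_mat_of_diags _.
have TN : LN_plus l T.
  apply/LN_plusP; split=> // [i|].
    by rewrite /T /mat_of_diags leqnn subnn; have [_ ->] := xP 0.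
  by exists N => d; rewrite diag_mat_of_diags; have [] := xP d.
exists T => // i j; have uhT := upper_h_shift uT.
have [ij|ij] := leqP i.+1 j; last first.
  rewrite mat_mul_Lambda_r//.
  - rewrite [mat_mul _ _ _ _]upper_mul// addr0.
    move: ij; rewrite ltnS leq_eqVlt => /orP[/eqP->|ji].
      by rewrite h_shift_one//; case/LN_plusP: TN.
    by rewrite uhT// uT.
  - exact: LN_plus_laurent_h.
  - exact: Lb_plus_laurent.
rewrite -(subnKC ij); move: (j - i.+1)%N => {ij} d.
rewrite gauge_row_step// addSnnS -[T i _]/(diag T d.+1 i).
apply/funext => m; apply/funext => t; rewrite ser_addE.
rewrite -[diag (h_shift q T) _ _ _ _]/(q ^ m * diag T d.+1 i.+1 m t).
rewrite diag_mat_of_diags; have [_ xE] := xP d.+1; rewrite [RHS]xE.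
suff -> : diag (mat_mul (h_shift q T) A) d i.+1 = W x d i.+1 by [].
rewrite diag_mul//; apply: eq_bigr => e _; congr ser_mul.
by rewrite -[LHS]/(h (diag T e i.+1)) diag_mat_of_diags.
Qed.

(** If [T1] and [T2] agree up to diagonal [d], their difference D on the next
    diagonal satisfies the homogeneous equation, so on the coefficient of z^m it
    is D_i(t) = q^(-mi) D_0(t). The vanishing condition D_(p-1)(p) = 0 makes D_0
    vanish at all large integers [p], hence identically. *)
Lemma gauge_normalizer_unique (A T1 T2 : mat R) :
  0 < `|q| -> `|q| < 1 -> cexp l = q -> Lb_plus l A ->
  LN_plus l T1 -> LN_plus l T2 ->
  (forall i j, mat_mul (h_shift q T1) (Lambda R + A) i.+1 j = T1 i j) ->
  (forall i j, mat_mul (h_shift q T2) (Lambda R + A) i.+1 j = T2 i j) ->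
  T1 = T2.
Proof.
move=> q_gt0 q_lt1 lE AB T1N T2N E1 E2.
have q_neq0 : q != 0 by rewrite -normr_gt0.
have uA : upper A by case: AB.
have uT1 := LN_plus_upper T1N; have uT2 := LN_plus_upper T2N.
have uhT1 := upper_h_shift uT1; have uhT2 := upper_h_shift uT2.
apply: upper_ext => //.
elim/ltn_ind => -[_|d IHd]; first by rewrite !LN_plus_diag0.
have hTA : diag (mat_mul (h_shift q T1) A) d = diag (mat_mul (h_shift q T2) A) d.
  apply: diag_mul_eql => // e ed; exact/diag_h_shift_eq/IHd.
have [_ _ [N1 T1R]] := (LN_plusP l T1).1 T1N.
have [_ _ [N2 T2R]] := (LN_plusP l T2).1 T2N.
have {T1R}R1 := regular_diag_weaken (leq_maxl N1 N2) (T1R d.+1).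
have {T2R}R2 := regular_diag_weaken (leq_maxr N1 N2) (T2R d.+1).
have [DA _ D0 _] := regular_diagD R1 (regular_diagN R2).
pose D i m t := diag T1 d.+1 i m t - diag T2 d.+1 i m t.
have step (T : mat R) i m t : LN_plus l T ->
    (forall i j, mat_mul (h_shift q T) (Lambda R + A) i.+1 j = T i j) ->
    diag T d.+1 i m t = q ^ m * diag T d.+1 i.+1 m t +
      diag (mat_mul (h_shift q T) A) d i.+1 m t.
  move=> TN TE; have := gauge_row_step d i.+1 TN AB.
  by rewrite TE addSnnS => /(congr1 (fun u => u m t)).
have DS i m t : D i m t = q ^ m * D i.+1 m t.
  rewrite /D (step T1)// (step T2)// hTA; ring.
have Diter i m t : D 0 m t = (q ^ m) ^+ i * D i m t.
  elim: i => [|i ->]; first by rewrite mul1r.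
  by rewrite [D i m t]DS exprSr mulrA.
have D00 m : D 0 m = 0.
  apply: (@A0_eventually0 _ _ _ q_gt0 q_lt1 lE _ (maxn N1 N2).+1).
    exact: (DA 0 m).
  move=> [//|p] Np; rewrite (Diter p).
  rewrite [D p m _](D0 m p.+1 p) ?mulr0// addnS ltnS; exact: leq_addr.
apply/funext => i; apply/funext => m; apply/funext => t; apply/eqP.
have := Diter i m t; rewrite D00 => /esym/eqP; rewrite mulf_eq0 expf_eq0.
by rewrite expfz_eq0 (negPf q_neq0) !andbF subr_eq0.
Qed.

Lemma A0_laurent_gauge_row (T A : mat R) i j : LN_plus l T -> Lb_plus l A ->
  A0_laurent l (gauge q l T (Lambda R + A) i j).
Proof.
move=> TN AB; have [UN _ _] := LN_invP TN.
have A0T (B : mat R) N : upper B -> (forall d, regular_diag l N d (diag B d)) ->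
    forall a b, A0_laurent l (B a b).
  move=> uB BN a b; have [ab|ba] := leqP a b.
    by have := regular_diag_A0 (BN (b - a)%N) a; rewrite /diag subnKC.
  by rewrite uB//; apply: A0_laurentP; [exact: laurent0|move=> c; exact: A0_0].
have [uA [N AN]] := (Lb_plusP l A).1 AB.
have [uT _ [N1 TR]] := (LN_plusP l T).1 TN.
have [uU _ [N2 UR]] := (LN_plusP l _).1 UN.
have uhT := upper_h_shift uT.
have hT a b : A0_laurent l (h_shift q T a b).
  by apply: A0T => // d; exact: regular_diag_h_shift.
rewrite /gauge (mat_mul_upper _ _ uU (ltnSn j)); apply: A0_laurent_sum => k.
apply: A0_laurent_mul; last exact: A0T UR _ _.
rewrite mat_mul_Lambda_r//; [|exact: LN_plus_laurent_h|exact: Lb_plus_laurent].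
apply: A0_laurentD => //; rewrite (mat_mul_upper _ _ uA (ltnSn k)).
apply: A0_laurent_sum => c; apply: A0_laurent_mul => //; exact: A0T AN _ _.
Qed.

Lemma companion_Y_q : (companion l `<=` Y_q l)%classic.
Proof.
move=> _ [u uA <-].
exists (fun i j => if i == 0%N then u j else 0); last first.
  apply/funext => -[|i]; apply/funext => j; rewrite mat_addE /Lambda /=.
    by rewrite add0r.
  by rewrite addr0 eqSS.
apply/Lb_plusP; split=> [[|i] j|] //; exists 0%N => d.
split.
- move=> i m; rewrite /diag; case: eqP => [->|_]; last exact: A0_0.
  by have [+ _] := uA d; apply.
- move=> m; exists 0; first exact: A0_2_0.
  by move=> i i0 t; rewrite /diag gtn_eqF.
- by move=> m p i i0; rewrite /diag gtn_eqF.
- have [_ [M uM]] := uA d; exists `|M|%N => m Mm i; rewrite /diag.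
  by case: eqP => [->|//]; apply: uM; lia.
Qed.

Lemma laurent_gauge_row (T A : mat R) : LN_plus l T -> Lb_plus l A ->
  laurent_mat (mat_mul (h_shift q T) (Lambda R + A)).
Proof.
move=> TN AB i j; rewrite mat_mul_Lambda_r.
- apply: laurentD; first exact: LN_plus_laurent_h.
  have uA : upper A by case: AB.
  rewrite (mat_mul_upper _ _ uA (ltnSn j)); apply: laurent_sum => k.
  by apply: laurent_mul; [exact: LN_plus_laurent_h|exact: Lb_plus_laurent].
- exact: LN_plus_laurent_h.
- exact: Lb_plus_laurent.
- by case: AB.
Qed.

(** A companion matrix [L] is characterized by (L T)_(i+1,j) = T_(i,j), that is, by
    its rows other than the first; the first row is then whatever the product
    gives, and its entries are Laurent series over A_0. *)
Lemma gauge_companion_rows (T A : mat R) : LN_plus l T -> Lb_plus l A ->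
  companion l (gauge q l T (Lambda R + A)) <->
  forall i j, mat_mul (h_shift q T) (Lambda R + A) i.+1 j = T i j.
Proof.
move=> TN AB; have [UN TU UT] := LN_invP TN.
have LX := laurent_gauge_row TN AB.
split=> [[u uA uE] i j|E].
  rewrite (gauge_mulr TN LX) -uE mat_mul_companion//; exact: LN_plus_upper TN.
exists (gauge q l T (Lambda R + A) 0).
  by move=> j; exact: A0_laurent_gauge_row.
apply/funext => -[//|i]; apply/funext => j; rewrite /companion_mat.
have /(congr1 (fun B : mat R => B i j)) := TU; rewrite {1}/mat_one => <-.
have uU := LN_plus_upper UN.
rewrite /gauge !(mat_mul_upper _ _ uU (ltnSn j)).
by apply: eq_bigr => k _; rewrite E.
Qed.

End GaugeAction.

Theorem theorem4p1 (R : realType) (q lnq : R[i]%C)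
    (hq0 : 0 < `|q|) (hq1 : `|q| < 1) (hlnq : is_ln q lnq) :
  free_action (gauge q lnq) (mat_one R) (LN_plus lnq) (Y_q lnq) /\
  cross_section (gauge q lnq) (LN_plus lnq) (Y_q lnq) (companion lnq).
Proof.
have [lE _] := hlnq; have q_neq0 : q != 0 by rewrite -normr_gt0.
split.
  move=> T _ TN [A AB <-] fixT; apply: (gauge_free q_neq0 TN AB).
  by rewrite (gauge_mulr TN (laurent_gauge_row q TN AB)) fixT.
split; first exact: companion_Y_q.
move=> _ [A AB <-]; have [T TN TE] := gauge_normalizer_exists q_neq0 lE AB.
exists (gauge q lnq T (Lambda R + A)); apply/seteqP; split=> [L' [[T' T'N <-]]|_ ->].
  move=> /(gauge_companion_rows q T'N AB) T'E.
  by rewrite /= (gauge_normalizer_unique hq0 hq1 lE AB T'N TN T'E TE).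
by split; [exists T|apply/gauge_companion_rows].
Qed.
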